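(* Let $\mathbb{F}_q$ be a finite field with $q$ elements and let $\mathcal{A}$ be any finite dimensional (associative, not necessarily commutative) algebra with unity over $\mathbb{F}_q$. Then the generating function $h_{\mathcal{A}}(t) = 1+\sum_{k=1}^{\infty} c_{\mathcal{A},k}\,t^k$ is a rational function of $t$.
   Context: $\mathcal{A}^*$ denotes the group of units of $\mathcal{A}$. For $k\ge 1$, $\mathcal{A}^{(k)} = \{(a_1,\ldots,a_k)\in\mathcal{A}^k : a_ia_j=a_ja_i \text{ for } i\ne j\}$ is the set of $k$-tuples with pairwise commuting entries. The group $\mathcal{A}^*$ acts on $\mathcal{A}^{(k)}$ by simultaneous conjugation, $g\cdot(a_1,\ldots,a_k) = (ga_1g^{-1},\ldots,ga_kg^{-1})$, and $c_{\mathcal{A},k}$ denotes the number of orbits of this action. That a formal power series is a rational function means that it is the power series expansion of a quotient of two polynomials in $t$. *)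

(* Defs.v *)
From HB Require Import structures.
From mathcomp Require Import all_boot all_order all_algebra all_fingroup all_field.

Set Implicit Arguments.
Unset Strict Implicit.
Unset Printing Implicit Defensive.

Import GRing.Theory.
Local Open Scope ring_scope.

Definition commuting_tuples (R : finUnitRingType) (k : nat) : {set k.-tuple R} :=
  [set a : k.-tuple R | [forall i, forall j,
     (i != j) ==> (tnth a i * tnth a j == tnth a j * tnth a i)]].

Definition conj_tuple (R : finUnitRingType) (k : nat) (g : {unit R})
    (a : k.-tuple R) : k.-tuple R :=
  [tuple val g * tnth a i * (val g)^-1 | i < k].

(* The library's actions are right actions, whereas conj_tuple is the left
   action g.a = g a g^-1, so its orbits are written out. *)
Definition conj_orbit (R : finUnitRingType) (k : nat) (a : k.-tuple R) :
    {set k.-tuple R} :=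
  [set conj_tuple g a | g : {unit R}].

(* A falgType over a finite field carries no canonical finType structure;
   finvect_type A is A itself, equipped with one. *)
Definition num_conj_orbits (F : finFieldType) (A : falgType F) (k : nat) : nat :=
  #|[set conj_orbit a | a in commuting_tuples (finvect_type A) k]|.

Definition orbit_series (F : finFieldType) (A : falgType F) (k : nat) : rat :=
  if k is 0%N then 1 else (num_conj_orbits A k)%:R.

(* A formal power series is given by its sequence of coefficients.  A quotient
   P / Q has a power series expansion when Q(0) is nonzero, and this expansion
   is the unique series h whose Cauchy product with Q is P. *)
Definition rational_series (K : fieldType) (h : nat -> K) : Prop :=
  exists P Q : {poly K},
    Q`_0 != 0 /\ forall n : nat, \sum_(i < n.+1) Q`_i * h (n - i)%N = P`_n.

(* Main.v *)
Require Import Defs.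
From HB Require Import structures.
From mathcomp Require Import all_boot all_order all_algebra all_fingroup all_field.

(** By Burnside's lemma, [c_k] is the average over the units [g] of the number
    of commuting [k]-tuples in the centralizer of [g].  Commuting tuples are
    counted by a transfer matrix indexed by the subsets of the ring: choosing
    the first entry [x] in a subset [S] restricts the remaining entries to the
    elements of [S] commuting with [x].  Cayley-Hamilton for this matrix gives
    a linear recurrence for [c_k]. *)

Set Implicit Arguments.
Unset Strict Implicit.
Unset Printing Implicit Defensive.

Import GRing.Theory Num.Theory.
Local Open Scope ring_scope.

(** Multiplying [h] by the reciprocal polynomial of [p] turns the recurrence into the vanishing of
    all coefficients from the degree of [p] on. *)
Lemma rational_series_recurrence (K : fieldType) (p : {poly K}) (h : nat -> K) :
  p != 0 -> (forall n, \sum_(i < size p) p`_i * h (i + n)%N = 0) ->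
  rational_series h.
Proof.
move=> p_neq0 rec_h; have size_p : size p = (size p).-1.+1.
  by rewrite prednK // size_poly_gt0.
set d := (size p).-1 in size_p.
(* The constant term of [Q] is the leading coefficient of [p], hence nonzero. *)
pose Q := \poly_(i < d.+1) p`_(d - i).
exists (\poly_(n < d) \sum_(i < n.+1) Q`_i * h (n - i)%N), Q; split.
  by rewrite coef_poly subn0 -lead_coefE lead_coef_eq0.
move=> n; rewrite coef_poly; case: ltnP => // /subnK <-; move: (n - d)%N => m.
(* In degree [m + d], the terms of index above [d] vanish; the others, read in reverse order, form
   the recurrence at [m]. *)
rewrite addnC -addSn big_split_ord /= addrC big1 => [|i _]; last first.
  by rewrite coef_poly ltnNge leq_addr mul0r.
rewrite add0r -[RHS](rec_h m) size_p (reindex_inj rev_ord_inj) /=.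
apply: eq_bigr => i _; rewrite coef_poly subSS ltnS leq_subr.
have le_id : (i <= d)%N by rewrite -ltnS.
by rewrite subKn // [(d + m)%N]addnC -addnBA ?leq_subr // subKn // addnC.
Qed.

Lemma Cayley_Hamilton_sum (K : comNzRingType) n (M : 'M[K]_n) :
  \sum_(i < size (char_poly M)) (char_poly M)`_i *: M ^+ i = 0.
Proof.
(* [Cayley_Hamilton] is stated for positive size; in size 0 all matrices are equal. *)
case: n M => [|n] M; first by rewrite [LHS]thinmx0 [RHS]thinmx0.
rewrite -[RHS](Cayley_Hamilton M) -[in RHS](coefK (char_poly M)) poly_def.
rewrite raddf_sum; apply: eq_bigr => i _.
by rewrite /= horner_mxZ rmorphXn /= horner_mx_X.
Qed.

(** The vectors [v k] satisfy [v (k + n) = M ^+ k *m v n], so the characteristic polynomial of [M]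
    gives one recurrence valid for every coordinate, hence for any fixed linear combination of
    them. *)
Lemma rational_series_transfer (K : fieldType) (T : finType) (w : T -> T -> K)
    (u : T -> K) (f : nat -> T -> K) :
  (forall k s, f k.+1 s = \sum_t w s t * f k t) ->
  rational_series (fun k => \sum_s u s * f k s).
Proof.
move=> fS; pose M := \matrix_(i, j < #|T|) w (enum_val i) (enum_val j).
pose v k := \col_(i < #|T|) f k (enum_val i).
have vD k n : v (k + n)%N = M ^+ k *m v n.
  elim: k => [|k IHk]; first by rewrite expr0 mul1mx.
  rewrite exprS -[_ * _]/(_ *m _) -mulmxA -IHk; apply/colP=> i.
  rewrite !mxE addSn fS big_enum_val; apply: eq_bigr => j _.
  by rewrite !mxE.
apply: (@rational_series_recurrence _ (char_poly M)) => [|n].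
  exact/monic_neq0/char_poly_monic.
under eq_bigr do rewrite mulr_sumr.
rewrite exchange_big big1 // => s _.
have /colP/(_ (enum_rank s)) : \sum_(i < size (char_poly M))
    (char_poly M)`_i *: v (i + n)%N = 0.
  rewrite -[RHS](mul0mx _ (v n)) -(Cayley_Hamilton_sum M) mulmx_suml.
  by apply: eq_bigr => i _; rewrite vD scalemxAl.
rewrite summxE mxE => eq0; apply: etrans (mulr0 (u s)).
rewrite -[in RHS]eq0 mulr_sumr; apply: eq_bigr => i _.
by rewrite !mxE enum_rankK mulrCA.
Qed.

Section PairwiseTuples.

Variables (X : finType) (e : rel X).

Definition num_pairwise_tuples (k : nat) (S : {set X}) : nat :=
  #|[set a : k.-tuple X | all (mem S) a && pairwise e a]|.

Lemma num_pairwise_tuplesS k S :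
  num_pairwise_tuples k.+1 S
  = (\sum_(x in S) num_pairwise_tuples k (S :&: [set y | e x y]))%N.
Proof.
rewrite /num_pairwise_tuples -sum1_card (partition_big (@thead _ _) (mem S)) /=.
  apply: eq_bigr => x xS; rewrite -sum1_card.
  rewrite (reindex (fun a : k.-tuple X => [tuple of x :: a])) /=.
    apply: eq_bigl => a; rewrite !inE theadE eqxx andbT /= xS.
    rewrite andbA -all_predI; congr (_ && _); apply: eq_all => y.
    by rewrite !inE.
  exists (fun a : k.+1.-tuple X => [tuple of behead a]) => [a _|a].
    exact: val_inj.
  by rewrite inE => /andP[_ /eqP <-]; rewrite [RHS]tuple_eta.
by move=> a; rewrite inE [a]tuple_eta theadE => /andP[/andP[]].
Qed.

Lemma rational_series_pairwise_tuples (K : fieldType) (u : {set X} -> K) :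
  rational_series (fun k => \sum_S u S * (num_pairwise_tuples k S)%:R).
Proof.
(* The entry at [S], [T] counts the heads [x] in [S] that leave exactly [T] for the tail. *)
pose w (S T : {set X}) : K := \sum_(x in S) (T == S :&: [set y | e x y])%:R.
apply: (@rational_series_transfer _ _ w) => k S.
rewrite num_pairwise_tuplesS natr_sum.
under [RHS]eq_bigr do rewrite mulr_suml.
rewrite exchange_big; apply: eq_bigr => x _ /=.
rewrite (bigD1 (S :&: [set y | e x y])) //= eqxx mul1r big1 ?addr0 // => T.
by move=> /negPf->; rewrite mul0r.
Qed.

End PairwiseTuples.

Section ConjugationOrbits.

Variable R : finUnitRingType.

Definition commr_rel : rel R := fun x y => x * y == y * x.

(** [pairwise] only tests indices [i < j]; the symmetry of commutation supplies the other pairs. *)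
Lemma mem_commuting_tuples k (a : k.-tuple R) :
  (a \in commuting_tuples R k) = pairwise commr_rel a.
Proof.
rewrite inE; apply/forallP/(pairwiseP 0) => [com_a i j|com_a i].
  rewrite !inE size_tuple => ltik ltjk ltij.
  have /forallP/(_ (Ordinal ltjk)) := com_a (Ordinal ltik).
  by rewrite -val_eqE /= ltn_eqF // !(tnth_nth 0).
apply/forallP=> j; apply/implyP; rewrite -val_eqE !(tnth_nth 0) neq_ltn.
by case/orP=> ltij; [|rewrite eq_sym]; apply: com_a; rewrite // inE size_tuple.
Qed.

(* The inverse turns the left action [conj_tuple] into a right action. *)
Definition conj_tuple_act k (a : k.-tuple R) (g : {unit R}) :=
  conj_tuple g^-1%g a.

Lemma conj_tuple_act1 k : (@conj_tuple_act k)^~ 1%g =1 id.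
Proof.
move=> a; apply: eq_from_tnth => i.
by rewrite tnth_mktuple invg1 /= invr1 mul1r mulr1.
Qed.

Lemma conj_tuple_actM k (a : k.-tuple R) : act_morph (@conj_tuple_act k) a.
Proof.
move=> g h; apply: eq_from_tnth => i; rewrite !tnth_mktuple invMg /=.
by rewrite invrM ?unitrV ?(valP g) ?(valP h) // !mulrA.
Qed.

Canonical conj_tuple_action k :=
  TotalAction (@conj_tuple_act1 k) (@conj_tuple_actM k).

Lemma conj_orbitE k (a : k.-tuple R) :
  conj_orbit a = orbit (conj_tuple_action k) [set: {unit R}] a.
Proof.
apply/setP=> b; apply/imsetP/imsetP=> -[g _ ->]; exists g^-1%g; rewrite ?inE //.
by rewrite /= /conj_tuple_act invgK.
Qed.

(** Since [conj_tuple_act] inverts [g], this is the form in which an entry being fixed by [g]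
    appears. *)
Lemma conjVr_fixP (g : {unit R}) (x : R) :
  reflect ((val g)^-1 * x * (val g)^-1^-1 = x) (commr_rel (val g) x).
Proof.
have Ug := valP g; rewrite invrK; apply: (iffP eqP) => [com_gx|fix_x].
  by rewrite -mulrA -com_gx mulKr.
by rewrite -[in LHS]fix_x -mulrA mulVKr.
Qed.

Lemma acts_conj_tuple k :
  [acts [set: {unit R}], on commuting_tuples R k | conj_tuple_action k].
Proof.
apply/actsP=> g _ a.
(* Stability under every unit suffices: acting by the inverse gives the converse. *)
suff sub h b : b \in commuting_tuples R k ->
    conj_tuple_action k b h \in commuting_tuples R k.
  by apply/idP/idP=> /sub // /(_ g^-1%g); rewrite actK.
rewrite !inE => /forallP com_b; apply/forallP=> i; apply/forallP=> j.
apply/implyP=> neq_ij; rewrite !tnth_mktuple.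
have /forallP/(_ j)/implyP/(_ neq_ij)/eqP comij := com_b i.
have Uh := valP h^-1%g.
by rewrite !mulrA !mulrVK // -[X in X / _]mulrA comij mulrA.
Qed.

Definition unit_centralizer (g : {unit R}) : {set R} :=
  [set x | commr_rel (val g) x].

Lemma card_Fix_conj_tuple k (g : {unit R}) :
  #|'Fix_(commuting_tuples R k | conj_tuple_action k)[g]%g|
  = num_pairwise_tuples commr_rel k (unit_centralizer g).
Proof.
apply: eq_card => a; rewrite in_setI mem_commuting_tuples [RHS]inE andbC.
congr (_ && _).
apply/afix1P/allP => [fix_a x /tnthP[i ->]|com_a].
  by rewrite !inE; apply/conjVr_fixP; rewrite -{2}fix_a tnth_mktuple.
apply: eq_from_tnth => i; rewrite tnth_mktuple; apply/conjVr_fixP.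
by have := com_a _ (mem_tnth i a); rewrite !inE.
Qed.

Lemma rational_series_conj_orbits :
  rational_series
    (fun k => #|[set conj_orbit a | a in commuting_tuples R k]|%:R : rat).
Proof.
pose G := [set: {unit R}].
(* [u S] is the proportion of units with centralizer [S], so the weighted sum over [S] is the
   Burnside average. *)
pose u (S : {set R}) : rat :=
  \sum_(g in G) (S == unit_centralizer g)%:R / #|G|%:R.
have [P [Q [Q0 PQ]]] := rational_series_pairwise_tuples commr_rel u.
exists P, Q; split=> // n; rewrite -PQ; apply: eq_bigr => i _; congr (_ * _).
move: (n - i)%N => {n i PQ} k.
have G_neq0 : #|G|%:R != 0 :> rat by rewrite pnatr_eq0 -lt0n cardG_gt0.
(* [Frobenius_Cauchy] gives the number of orbits times the group order, hence the multiplication by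
   [#|G|]. *)
apply: (mulIf G_neq0); rewrite -natrM (eq_imset _ (@conj_orbitE k)).
rewrite -(Frobenius_Cauchy (acts_conj_tuple k)) natr_sum mulr_suml.
under [RHS]eq_bigr do rewrite !mulr_suml.
rewrite exchange_big; apply: eq_bigr => g _ /=.
rewrite card_Fix_conj_tuple (bigD1 (unit_centralizer g)) //= eqxx big1.
  by rewrite addr0 mul1r mulrAC mulVf // mul1r.
by move=> S /negPf->; rewrite !mul0r.
Qed.

(** The empty tuple is the only 0-tuple; thus the constant term 1 set apart in [orbit_series] agrees
    with the orbit count. *)
Lemma card_conj_orbits0 :
  #|[set conj_orbit a | a in commuting_tuples R 0]| = 1%N.
Proof.
have -> : commuting_tuples R 0 = [set [tuple]].
  by apply/setP=> a; rewrite mem_commuting_tuples tuple0 inE eqxx.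
by rewrite imset_set1 cards1.
Qed.

End ConjugationOrbits.

Theorem theorem1p2 (F : finFieldType) (A : falgType F) :
  rational_series (orbit_series A).
Proof.
have [P [Q [Q0 PQ]]] := rational_series_conj_orbits (finvect_type A).
exists P, Q; split=> // n; rewrite -PQ; apply: eq_bigr => i _; congr (_ * _).
by case: (n - i)%N => [|k] //=; rewrite card_conj_orbits0.
Qed.
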